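(* Let $(k,|\cdot|)$ be a complete non-Archimedean field of characteristic $p>0$ with nontrivial value group. The following are equivalent: (i) $K_n(k)$ is Frobenius split for each integer $n>0$; (ii) $K_n(k)$ has a nonzero $p^{-1}$-linear map for each integer $n>0$; (iii) there exists an integer $n>0$ for which $K_n(k)$ has a nonzero $p^{-1}$-linear map; (iv) $K_1(k)$ has a nonzero $p^{-1}$-linear map; (v) $K_1(k)$ is Frobenius split; (vi) there exists a nonzero continuous $k$-linear map $f\colon k^{1/p}\to k$.
   Context: A non-Archimedean field is a field with a multiplicative absolute value satisfying the ultrametric inequality, assumed complete and with nontrivial value group. The convergent power series ring $K_n(k)=k\langle X_1,\dots,X_n\rangle$ is the subring of $k[[X_1,\dots,X_n]]$ of series $\sum_{\nu}a_\nu X^\nu$ for which there exist real $r_1,\dots,r_n>0$ and $M>0$ with $|a_\nu|r_1^{\nu_1}\cdots r_n^{\nu_n}\le M$ for all $\nu\in\mathbb{Z}_{\ge0}^n$. For a ring $R$ of characteristic $p$, a $p^{-1}$-linear map is an $R$-linear map $F_{R*}R\to R$, where $F_{R*}R$ is $R$ with module structure $r\cdot x=r^px$; $R$ is Frobenius split if some such map sends $1$ to $1$. $k^{1/p}$ carries the unique absolute value extending that of $k$; continuity refers to the metric topologies. *)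

(* Defs.v *)
(* for the field k; Stdlib reals for the absolute value.
   Real-number operations are written with their names (Rle, Rlt, Rmult, ...)
   to avoid the %R scope-key clash between ring_scope and R_scope. *)
From Stdlib Require Import Reals ClassicalEpsilon.
From HB Require Import structures.
From mathcomp Require Import all_boot all_order all_algebra.
Set Implicit Arguments. Unset Strict Implicit. Unset Printing Implicit Defensive.
Import GRing.Theory.
Local Open Scope ring_scope.

Definition nonarch_abs (k : fieldType) (abs : k -> R) : Prop :=
  (forall x, Rle R0 (abs x)) /\
  (forall x, abs x = R0 <-> x = 0) /\
  (forall x y, abs (x * y) = Rmult (abs x) (abs y)) /\
  (forall x y, Rle (abs (x + y)) (Rmax (abs x) (abs y))).

Definition abs_cauchy (k : fieldType) (abs : k -> R) (u : nat -> k) : Prop :=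
  forall eps, Rlt R0 eps -> exists N : nat, forall m m',
    (N <= m)%N -> (N <= m')%N -> Rlt (abs (u m - u m')) eps.

Definition abs_lim (k : fieldType) (abs : k -> R) (u : nat -> k) (l : k) : Prop :=
  forall eps, Rlt R0 eps -> exists N : nat, forall m,
    (N <= m)%N -> Rlt (abs (u m - l)) eps.

Definition nonarch_field (k : fieldType) (abs : k -> R) : Prop :=
  nonarch_abs abs /\
  (forall u, abs_cauchy abs u -> exists l, abs_lim abs u l) /\
  (exists x : k, abs x <> R0 /\ abs x <> R1).

Definition series (k : Type) (n : nat) := ('I_n -> nat) -> k.

Section Series.
Variables (k : fieldType) (n : nat).

Definition zero_ps : series k n := fun _ => 0.
Definition one_ps : series k n := fun nu => if [forall i, nu i == 0%N] then 1 else 0.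
Definition add_ps (a b : series k n) : series k n := fun nu => a nu + b nu.
(* Cauchy product: (ab)_nu = sum_{mu <= nu} a_mu b_{nu - mu}; every mu <= nu
   has mu_i < (sum_i nu_i).+1, so it occurs exactly once in the sum. *)
Definition mul_ps (a b : series k n) : series k n := fun nu =>
  \sum_(mu : {ffun 'I_n -> 'I_(\sum_(i < n) nu i).+1} | [forall i, (mu i <= nu i)%N])
     a (fun i => nat_of_ord (mu i)) * b (fun i => (nu i - mu i)%N).
Definition pow_ps (a : series k n) (m : nat) : series k n := iter m (mul_ps a) one_ps.

Definition monoR (r : 'I_n -> R) (nu : 'I_n -> nat) : R :=
  foldr (fun i acc => Rmult (pow (r i) (nu i)) acc) R1 (enum 'I_n).

Definition convergent (abs : k -> R) (a : series k n) : Prop :=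
  exists r : 'I_n -> R, (forall i, Rlt R0 (r i)) /\
    exists M : R, Rlt R0 M /\ forall nu, Rle (Rmult (abs (a nu)) (monoR r nu)) M.

(* p^{-1}-linear maps K_n(k) -> K_n(k): maps F_* R -> R that are R-linear,
   i.e. additive and phi(r^p x) = r phi(x).  phi is given on all formal series
   but only its behaviour on K_n(k) matters. *)
Definition pinv_linear (abs : k -> R) (p : nat) (phi : series k n -> series k n) : Prop :=
  (forall x, convergent abs x -> convergent abs (phi x)) /\
  (forall x y, convergent abs x -> convergent abs y ->
     phi (add_ps x y) = add_ps (phi x) (phi y)) /\
  (forall r x, convergent abs r -> convergent abs x ->
     phi (mul_ps (pow_ps r p) x) = mul_ps r (phi x)).

Definition has_nonzero_pinv_map (abs : k -> R) (p : nat) : Prop :=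
  exists phi, pinv_linear abs p phi /\
    exists x, convergent abs x /\ phi x <> zero_ps.

Definition frobenius_split (abs : k -> R) (p : nat) : Prop :=
  exists phi, pinv_linear abs p phi /\ phi one_ps = one_ps.

End Series.

(* L together with iota : k -> L is a model of k^{1/p}: every element of L has
   its p-th power in k, and every element of k has a p-th root in L. *)
Definition is_pth_root_ext (k L : fieldType) (p : nat) (iota : k -> L) : Prop :=
  (forall y : L, exists a : k, iota a = y ^+ p) /\
  (forall a : k, exists y : L, y ^+ p = iota a).

(* The unique extension of |.| to k^{1/p}: |y| = |y^p|^{1/p}. *)
Definition abs_ext (k L : fieldType) (abs : k -> R) (p : nat) (iota : k -> L) (y : L) : R :=
  let a := epsilon (inhabits (0 : k)) (fun a => iota a = y ^+ p) in
  if Req_EM_T (abs a) R0 then R0 else Rpower (abs a) (Rinv (INR p)).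

Definition has_nonzero_cont_klinear (k L : fieldType) (abs : k -> R) (p : nat)
    (iota : k -> L) : Prop :=
  exists f : L -> k,
    (forall y z, f (y + z) = f y + f z) /\
    (forall a y, f (iota a * y) = a * f y) /\
    (forall y0 eps, Rlt R0 eps -> exists delta, Rlt R0 delta /\
       forall y, Rlt (abs_ext abs p iota (y - y0)) delta ->
                 Rlt (abs (f y - f y0)) eps) /\
    (exists y, f y <> 0).

(* Main.v *)
Require Import Defs.
From Stdlib Require Import Reals Lra ClassicalEpsilon FunctionalExtensionality.
From HB Require Import structures.
From mathcomp Require Import all_boot all_order all_algebra.
From mathcomp Require Import mpoly.
Set Implicit Arguments. Unset Strict Implicit. Unset Printing Implicit Defensive.

(* Continuous k-linear forms on k^(1/p) correspond to additive maps g : k -> k with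
   g (c^p a) = c g a that are bounded on the unit ball.  Such a g, normalised by g 1 = 1, splits
   Frobenius on K_n(k) through \sum a_nu X^nu |-> \sum g (a_(p nu)) X^nu.

   Conversely let phi be a p^(-1)-linear map with phi x <> 0.  Fix the exponents of all variables
   but X_0 and let f_m a be the coefficient of phi (a x) at X_0-degree m.  Let j be least with
   f_j <> 0.  If f_j were unbounded on the unit ball, one could choose inductively u_i in that ball
   with f_j u_i as large as desired; the series y = \sum_i u_i x X_0^(p i) converges, but the
   coefficient of phi y at degree s + j is f_j u_s plus terms depending only on the u_i with i < s,
   so it can be made to grow too fast for phi y to converge. *)

(** * Cauchy products and p-th powers of formal power series *)

Section PowerSeries.
Import GRing.Theory.
Local Open Scope ring_scope.
Variables (k : fieldType) (n : nat).
Implicit Types (a b x : series k n) (nu mu : 'I_n -> nat).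

Definition monomial_ps (c : k) mu : series k n :=
  fun nu => if [forall i, nu i == mu i] then c else 0.

Definition scale_ps (c : k) a : series k n := fun nu => c * a nu.

Lemma mul_monomial_ps c mu x nu :
  mul_ps (monomial_ps c mu) x nu =
  if [forall i, (mu i <= nu i)%N] then c * x (fun i => (nu i - mu i)%N) else 0.
Proof.
rewrite /mul_ps /monomial_ps; case: ifP => [/forallP le_mu|/negbT/forallPn[i lt_mu]].
  have lt i : (mu i < (\sum_(j < n) nu j).+1)%N.
    by rewrite ltnS (leq_trans (le_mu i)) // (bigD1 i) //= leq_addr.
  pose m := [ffun i => Ordinal (lt i)].
  rewrite (bigD1 m) /=; last by apply/forallP=> i; rewrite ffunE /= le_mu.
  rewrite [X in _ + X]big1 ?addr0 => [|h /andP[_ ne_h]]; last first.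
    case: ifP => [/forallP eq_h|]; last by rewrite mul0r.
    by case/eqP: ne_h; apply/ffunP=> i; apply/val_inj; rewrite ffunE; exact: (eqP (eq_h i)).
  case: ifP => [_|/negbT/forallPn[i]]; last by rewrite ffunE /= eqxx.
  by congr (_ * x _); apply/functional_extensionality => i; rewrite ffunE.
rewrite big1 // => h /forallP le_h; case: ifP => [/forallP eq_h|]; last by rewrite mul0r.
by case/negP: lt_mu; rewrite -(eqP (eq_h i)).
Qed.

Lemma pow_monomial_ps c mu m :
  pow_ps (monomial_ps c mu) m = monomial_ps (c ^+ m) (fun i => m * mu i)%N.
Proof.
elim: m => [|m IHm].
  by apply/functional_extensionality => nu; rewrite /pow_ps /= /one_ps expr0.
apply/functional_extensionality => nu; rewrite /pow_ps iterS.
rewrite [iter _ _ _]IHm mul_monomial_ps /monomial_ps.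
case: ifP => [/forallP le_mu|/negbT/forallPn[i lt_mu]].
  have -> : [forall i, (nu i - mu i)%N == (m * mu i)%N]
          = [forall i, nu i == (m.+1 * mu i)%N].
    by apply: eq_forallb => i; rewrite mulSn -{2}(subnKC (le_mu i)) eqn_add2l.
  by case: ifP; rewrite ?mulr0 ?exprS.
case: ifP => // /forallP/(_ i)/eqP eq_nu.
by case/negP: lt_mu; rewrite eq_nu mulSn leq_addr.
Qed.

(** Indexing by multinomials of bounded degree matches the products of [{mpoly k[n]}]. Both index
    sets contain every exponent below [nu], so they carry the same terms. *)
Lemma mul_psE a b nu d : (\sum_(i < n) nu i < d)%N ->
  mul_ps a b nu = \sum_(h : 'X_{1..n < d} | [forall i, (h i <= nu i)%N])
                    a h * b (fun i => (nu i - h i)%N).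
Proof.
move=> lt_d; rewrite /mul_ps; set e := (\sum_(i < n) nu i)%N in lt_d *.
have le_sum i : (nu i <= e)%N by rewrite /e (bigD1 i) //= leq_addr.
have d_gt0 : (0 < d)%N by apply: leq_ltn_trans lt_d.
have mdeg0d : (mdeg (0%MM : 'X_{1..n}) < d)%N by rewrite mdeg0.
(* [F] and [G] are mutually inverse only on exponents below [nu]; the default values of [inord] and
   [insubd] elsewhere are excluded by the guards of the sums. *)
pose F (h : 'X_{1..n < d}) : {ffun 'I_n -> 'I_e.+1} := [ffun i => inord (h i)].
pose G (m : {ffun 'I_n -> 'I_e.+1}) : 'X_{1..n < d} :=
  insubd (BMultinom mdeg0d) [multinom (m i : nat) | i < n].
have GE (m : {ffun 'I_n -> 'I_e.+1}) : [forall i, (m i <= nu i)%N] -> G m =1 (fun i => m i : nat).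
  move=> /forallP le_m i; rewrite /G insubdK ?mnmE // unfold_in mdegE.
  by apply: leq_ltn_trans lt_d; apply: leq_sum => j _; rewrite mnmE.
have FE (h : 'X_{1..n < d}) : [forall i, (h i <= nu i)%N] ->
    forall i, F h i = h i :> nat.
  by move=> /forallP le_h i; rewrite ffunE inordK // ltnS (leq_trans (le_h i)).
rewrite (reindex_onto F G) /=; last first.
  move=> m le_m; apply/ffunP => i; rewrite ffunE GE //; exact: inord_val.
apply: eq_big => [h|h /andP[le_F /eqP eq_h]]; last first.
  have E i : F h i = h i :> nat by rewrite -[in RHS]eq_h (GE _ le_F).
  by congr (a _ * b _); apply/functional_extensionality => i; rewrite E.
apply/andP/idP => [[le_F /eqP eq_h]|le_h].
  by apply/forallP => i; rewrite -eq_h GE // (forallP le_F).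
have E := FE h le_h.
have le_F : [forall i, (F h i <= nu i)%N].
  by apply/forallP => i; rewrite E (forallP le_h).
split=> //; apply/eqP/val_inj/mnmP => i.
by rewrite /= GE ?E.
Qed.

(** Series carry only raw operations here; ring laws are borrowed from polynomials that agree with
    them below degree [d]. *)
Definition trunc_ps (d : nat) a : {mpoly k[n]} :=
  \sum_(h : 'X_{1..n < d}) a h *: 'X_[h].

Lemma mcoeff_trunc_ps d a (m : 'X_{1..n}) : (mdeg m < d)%N -> (trunc_ps d a)@_m = a m.
Proof. by move=> lt_d; rewrite /trunc_ps (mcoeff_mpoly (fun m => a m)). Qed.

(** A coefficient of degree below [d] in a product involves only such coefficients of the
    factors. *)
Lemma mcoeff_mul_trunc d (P Q : {mpoly k[n]}) a b (m : 'X_{1..n}) :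
  (forall h : 'X_{1..n}, (mdeg h < d)%N -> P@_h = a h) ->
  (forall h : 'X_{1..n}, (mdeg h < d)%N -> Q@_h = b h) ->
  (mdeg m < d)%N -> (P * Q)@_m = mul_ps a b m.
Proof.
move=> EP EQ lt_d; rewrite (mul_psE _ _ (d := d)) -?mdegE //.
rewrite [(P * Q)@_m](mcoeff_poly_mul_lin P Q lt_d).
apply: eq_big => [h|h le_h]; first exact/mnm_lepP/forallP.
rewrite EP ?bmdeg // EQ; last exact: leq_ltn_trans (mdegB _ _) lt_d.
by congr (_ * b _); apply/functional_extensionality => i; rewrite mnmBE.
Qed.

Lemma mcoeff_pow_trunc d a e (m : 'X_{1..n}) :
  (mdeg m < d)%N -> (trunc_ps d a ^+ e)@_m = pow_ps a e m.
Proof.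
elim: e m => [|e IHe] m lt_d.
  rewrite expr0 mcoeff1 /pow_ps /= /one_ps.
  have -> : (m == 0%MM) = [forall i, m i == 0%N].
    apply/eqP/forallP => [-> i|m0]; first by rewrite mnm0E.
    by apply/mnmP=> i; rewrite mnm0E (eqP (m0 i)).
  by case: ifP.
rewrite exprS; apply: mcoeff_mul_trunc lt_d => [h|h]; [exact: mcoeff_trunc_ps|exact: IHe].
Qed.

Lemma trunc_ps_frobenius p d a : p \in [pchar k] ->
  trunc_ps d a ^+ p = \sum_(h : 'X_{1..n < d}) a h ^+ p *: 'X_[h *+ p].
Proof.
move=> Hp; have HP : p \in [pchar {mpoly k[n]}] by rewrite pchar_lalg.
rewrite -(pFrobenius_autE HP) /trunc_ps rmorph_sum.
by apply: eq_bigr => h _; rewrite -mpolyXn -exprZn.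
Qed.

(* The truncations live in a commutative ring of characteristic p, where Frobenius is additive. *)
Lemma mul_pow_psE p d a x nu : p \in [pchar k] -> (\sum_(i < n) p * nu i < d)%N ->
  mul_ps (pow_ps a p) x (fun i => p * nu i)%N =
  \sum_(h : 'X_{1..n < d} | [forall i, (h i <= nu i)%N])
     a h ^+ p * x (fun i => p * (nu i - h i))%N.
Proof.
move=> Hp lt_d; have p_gt0 : (0 < p)%N by rewrite prime_gt0 ?(pcharf_prime Hp).
pose m := [multinom (p * nu i)%N | i < n].
have mE : (m : 'I_n -> nat) = (fun i => p * nu i)%N.
  by apply/functional_extensionality => i; rewrite mnmE.
have lt_m : (mdeg m < d)%N by rewrite mdegE; under eq_bigr do rewrite mnmE.
rewrite -mE -(@mcoeff_mul_trunc d (trunc_ps d a ^+ p) (trunc_ps d x)) //; last 2 first.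
- by move=> h; exact: mcoeff_pow_trunc.
- by move=> h; exact: mcoeff_trunc_ps.
rewrite trunc_ps_frobenius // mulr_suml raddf_sum /= [RHS]big_mkcond /=.
apply: eq_bigr => h _; rewrite -scalerAl mcoeffZ.
(* Multiplication by ['X_[h *+ p]] only shifts exponents, so each summand contributes at most one
   coefficient of [x]. *)
rewrite (mcoeff_mul_trunc (d := d) (a := monomial_ps 1 (h *+ p)%MM) (b := x)) //; last 2 first.
- move=> h' _; rewrite mcoeffX /monomial_ps.
  have -> : ((h *+ p)%MM == h') = [forall i, h' i == (h *+ p)%MM i].
    by apply/eqP/forallP => [<- //|E]; apply/mnmP => i; rewrite (eqP (E i)).
  by case: ifP.
- by move=> h'; exact: mcoeff_trunc_ps.
rewrite mul_monomial_ps.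
have -> : [forall i, ((h *+ p)%MM i <= m i)%N] = [forall i, (h i <= nu i)%N].
  by apply: eq_forallb => i; rewrite mulmnE mnmE mulnC leq_pmul2l.
case: ifP => _; rewrite ?mulr0 // mul1r; congr (_ * x _).
by apply/functional_extensionality => i; rewrite mulmnE mnmE mulnBr [(h i * p)%N]mulnC.
Qed.

End PowerSeries.

(** * Ultrametric estimates, and convergence with a single radius *)

Section NonarchAbs.
Import GRing.Theory.
Local Open Scope ring_scope.
Local Delimit Scope R_scope with Re.
Variables (k : fieldType) (abs : k -> R).
Hypothesis Habs : nonarch_abs abs.

Lemma abs_ge0 x : (0 <= abs x)%Re. Proof. by case: Habs. Qed.

Lemma abs_eq0 x : abs x = 0%Re <-> x = 0. Proof. by case: Habs => _ []. Qed.

Lemma absM x y : abs (x * y) = (abs x * abs y)%Re.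
Proof. by case: Habs => _ [_ []]. Qed.

Lemma absD x y : (abs (x + y) <= Rmax (abs x) (abs y))%Re.
Proof. by case: Habs => _ [_ []]. Qed.

Lemma abs0 : abs 0 = 0%Re. Proof. exact/abs_eq0. Qed.

Lemma abs_gt0 x : x != 0 -> (0 < abs x)%Re.
Proof. by move=> /eqP x0; case: (abs_ge0 x) => // /esym/abs_eq0. Qed.

Lemma abs1 : abs 1 = 1%Re.
Proof.
have := absM 1 1; have := abs_gt0 (oner_neq0 k); rewrite mulr1.
by set z := abs 1 => z0 zz; apply: (Rmult_eq_reg_l z); lra.
Qed.

Lemma absN1 : abs (-1) = 1%Re.
Proof.
have := absM (-1) (-1); have := abs_ge0 (-1); rewrite mulrNN mulr1 abs1.
set z := abs (-1) => z0 zz.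
by have /Rmult_integral[] : ((z - 1) * (z + 1) = 0)%Re; lra.
Qed.

Lemma absN x : abs (- x) = abs x.
Proof. by rewrite -mulN1r absM absN1 Rmult_1_l. Qed.

Lemma absX x m : abs (x ^+ m) = pow (abs x) m.
Proof. by elim: m => [|m IHm]; rewrite ?expr0 ?abs1 // exprS absM IHm. Qed.

Lemma abs_sum_le (I : Type) (r : seq I) (P : pred I) (F : I -> k) (B : R) :
  (0 <= B)%Re -> (forall i, P i -> (abs (F i) <= B)%Re) ->
  (abs (\sum_(i <- r | P i) F i) <= B)%Re.
Proof.
move=> B0 FB; elim/big_ind: _ => [|x y xB yB|i /FB //]; first by rewrite abs0.
by apply: Rle_trans (absD x y) _; apply: Rmax_lub.
Qed.

(** Since [y = (x + y) - x] and [abs x] is too small to be the maximum, [abs y <= abs (x + y)]. *)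
Lemma abs_add_gt x y B : (B < abs y)%Re -> (abs x < abs y)%Re -> (B < abs (x + y))%Re.
Proof.
move=> By xy; have := absD (x + y) (- x); rewrite addrAC subrr add0r absN => H.
by move: H; rewrite /Rmax; case: Rle_dec => *; lra.
Qed.

Hypothesis Hnontriv : exists x : k, abs x <> 0%Re /\ abs x <> 1%Re.

Lemma exists_abs_lt1 : exists2 t, t != 0 & (abs t < 1)%Re.
Proof.
have [x [x0 x1]] := Hnontriv.
have nz : x != 0 by apply/eqP => /abs_eq0.
have [lt|ge] := Rlt_le_dec (abs x) 1; first by exists x.
exists x^-1; rewrite ?invr_neq0 //; have := absM x x^-1; rewrite divff // abs1 => E.
have := abs_gt0 nz; have := abs_ge0 x^-1 => ??.
apply: Rnot_le_lt => ge'; have : (abs x * 1 <= abs x * abs x^-1)%Re.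
  by apply: Rmult_le_compat_l => //; exact: abs_ge0.
by lra.
Qed.

Lemma exists_abs_lt eps : (0 < eps)%Re ->
  exists2 t, t != 0 & (abs t < 1)%Re /\ (abs t < eps)%Re.
Proof.
move=> eps0; have [t t0 t1] := exists_abs_lt1; have tp := abs_gt0 t0.
have [|N HN] := @pow_lt_1_zero (abs t) _ eps eps0; first by rewrite Rabs_pos_eq //; lra.
(* The exponent is positive, so the power stays below 1 as well as below [eps]. *)
exists (t ^+ N.+1); rewrite ?expf_neq0 // absX; split.
  by have [||_ //] := @pow_lt_1_compat (abs t) N.+1; [lra|apply/ltP].
have := HN N.+1 (Nat.le_succ_diag_r N); rewrite Rabs_pos_eq //; apply: pow_le; lra.
Qed.

Lemma exists_abs_gt B : exists2 t, t != 0 & (B < abs t)%Re.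
Proof.
have [m m0 Bm] : exists2 m, (0 < m)%Re & (B < m)%Re.
  by exists (Rmax B 0 + 1)%Re; have := Rmax_l B 0; have := Rmax_r B 0; lra.
have [|t t0 [_ tm]] := @exists_abs_lt (/ m); first exact: Rinv_0_lt_compat.
exists t^-1; rewrite ?invr_neq0 //.
have := absM t t^-1; rewrite divff // abs1 => E; have tp := abs_gt0 t0.
apply: (Rmult_lt_reg_l (abs t)) => //; rewrite -E.
apply: (Rlt_trans _ (abs t * m)); first exact: Rmult_lt_compat_l.
by rewrite -(Rinv_l m); [apply: Rmult_lt_compat_r|lra].
Qed.

Variable n : nat.

Lemma monoR_const t (nu : 'I_n -> nat) :
  monoR (fun=> t) nu = pow t (\sum_(i < n) nu i)%N.
Proof.
rewrite /monoR -big_enum /=.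
elim: (enum 'I_n) => [|i s IHs] /=; first by rewrite big_nil.
by rewrite big_cons pow_add IHs.
Qed.

Lemma monoR_le (r r' : 'I_n -> R) (nu : 'I_n -> nat) :
  (forall i, (0 <= r i <= r' i)%Re) -> (0 <= monoR r nu <= monoR r' nu)%Re.
Proof.
move=> le_r; rewrite /monoR; elim: (enum 'I_n) => [|i s [IH0 IH]] /=; first lra.
have [r0 rr] := le_r i; have P := pow_le _ (nu i) r0; split.
  exact: Rmult_le_pos.
by apply: Rmult_le_compat => //; apply: pow_incr.
Qed.

(** All radii can be shrunk to one radius [abs t]. Taking it in the value group lets powers of [t]
    move inside [abs] and through p^(-1)-linear forms. *)
Lemma convergentP (a : series k n) :
  convergent abs a <->
  exists t, t != 0 /\ (abs t < 1)%Re /\ exists M,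
    forall nu, (abs (a nu) * pow (abs t) (\sum_(i < n) nu i)%N <= M)%Re.
Proof.
split=> [[r [r0 [M [M0 aM]]]]|[t [t0 [t1 [M aM]]]]].
  have [e e0 er] : exists2 e, (0 < e)%Re & forall i, (e <= r i)%Re.
    have [e e0 er] : exists2 e, (0 < e)%Re & forall i, i \in enum 'I_n -> (e <= r i)%Re.
      elim: (enum 'I_n) => [|i s [e e0 er]]; first by exists 1%Re => //; lra.
      exists (Rmin e (r i)) => [|j]; first exact: Rmin_glb_lt.
      rewrite in_cons => /orP[/eqP ->|/er]; first exact: Rmin_r.
      by have := Rmin_l e (r i) => *; lra.
    by exists e => // i; apply: er; rewrite mem_enum.
  have [t t0 [t1 te]] := exists_abs_lt e0; have tp := abs_gt0 t0.
  exists t; split=> //; split=> //; exists M => nu; rewrite -monoR_const.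
  apply: Rle_trans (aM nu); apply: Rmult_le_compat_l; first exact: abs_ge0.
  by have [|_] := @monoR_le (fun=> abs t) r nu _ => // i; have := er i; lra.
exists (fun=> abs t); split=> [_|]; first exact: abs_gt0.
exists (Rmax M 1); split=> [|nu]; first by have := Rmax_r M 1; lra.
by rewrite monoR_const; apply: Rle_trans (Rmax_l M 1).
Qed.

End NonarchAbs.

(** * Bounded forms on k^(1/p) and the splittings they induce *)

Section PinvForms.
Import GRing.Theory.
Local Open Scope ring_scope.
Local Delimit Scope R_scope with Re.
Variables (k : fieldType) (abs : k -> R) (p : nat).
Hypothesis Habs : nonarch_abs abs.
Hypothesis Hnontriv : exists x : k, abs x <> 0%Re /\ abs x <> 1%Re.
Hypothesis Hp : p \in [pchar k].

(* A k-linear form on k^(1/p), read on k through the isomorphism y |-> y ^ p, with continuity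
   expressed as boundedness on the unit ball. *)
Definition bounded_pinv_form (g : k -> k) : Prop :=
  [/\ forall a b, g (a + b) = g a + g b,
      forall c a, g (c ^+ p * a) = c * g a &
      exists C, forall a, (abs a <= 1)%Re -> (abs (g a) <= C)%Re].

Let p_gt0 : (0 < p)%N. Proof. by rewrite prime_gt0 ?(pcharf_prime Hp). Qed.

Section RootExtension.
Variables (L : fieldType) (iota : {rmorphism k -> L}).
Hypothesis HL : is_pth_root_ext p iota.

(** Comparing p-th powers removes the real root; injectivity of [iota] makes [a] the element that
    [epsilon] picks. *)
Lemma abs_ext_lt y a delta : iota a = y ^+ p -> (0 < delta)%Re ->
  (abs_ext abs p iota y < delta)%Re <-> (abs a < pow delta p)%Re.
Proof.
move=> Ea d0; rewrite /abs_ext.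
have -> : epsilon (inhabits 0) (fun a => iota a = y ^+ p) = a.
  apply: (fmorph_inj iota); rewrite Ea.
  by apply: (epsilon_spec _ (fun a => iota a = y ^+ p)); exists a.
have dp : (0 < pow delta p)%Re by apply: pow_lt.
case: Req_EM_T => /= [a0|nz]; first by rewrite a0.
have a0 : (0 < abs a)%Re by have := abs_ge0 Habs a; lra.
set u := Rpower _ _; have u0 : (0 < u)%Re by apply: exp_pos.
have ip : (0 < INR p)%Re by apply: lt_0_INR; apply/ltP.
have -> : abs a = pow u p.
  by rewrite -Rpower_pow // Rpower_mult Rinv_l ?Rpower_1 //; lra.
split=> [lt|lt]; last first.
  by apply: Rnot_le_lt => ge; have := pow_incr delta u p; lra.
by rewrite -!Rpower_pow //; apply: Rlt_Rpower_l => //; lra.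
Qed.

Lemma pth_root_unique (y z : L) : y ^+ p = z ^+ p -> y = z.
Proof.
have HpL : p \in [pchar L] by rewrite (fmorph_pchar iota).
move=> E; apply/eqP; rewrite -subr_eq0; have: (y - z) ^+ p == 0.
  by rewrite -(pFrobenius_autE HpL) rmorphB /= !pFrobenius_autE E subrr.
by rewrite expf_eq0 => /andP[].
Qed.

Lemma cont_klinear_pinv_formP :
  has_nonzero_cont_klinear abs p iota <->
  exists2 g, bounded_pinv_form g & exists a, g a <> 0.
Proof.
have HpL : p \in [pchar L] by rewrite (fmorph_pchar iota).
have FrD (y z : L) : (y + z) ^+ p = y ^+ p + z ^+ p.
  by rewrite -!(pFrobenius_autE HpL) rmorphD.
have [powL rootL] := HL; split=> [[f [fD [fZ [fC [y0 fy0]]]]]|[g [gD gZ [C gC]] [a0 ga0]]].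
  pose rt a := proj1_sig (constructive_indefinite_description _ (rootL a)).
  have rtE a : rt a ^+ p = iota a.
    by rewrite /rt; case: constructive_indefinite_description.
  exists (fun a => f (rt a)); last first.
    have [a Ea] := powL y0; exists a.
    by have -> : rt a = y0 by apply: pth_root_unique; rewrite rtE.
  split=> [a b|c a|].
  - have -> : rt (a + b) = rt a + rt b; last exact: fD.
    by apply: pth_root_unique; rewrite FrD !rtE rmorphD.
  - have -> : rt (c ^+ p * a) = iota c * rt a; last exact: fZ.
    by apply: pth_root_unique; rewrite exprMn !rtE rmorphM rmorphXn.
  have f0 : f 0 = 0 by have := fZ 0 0; rewrite mulr0 mul0r.
  (* Multiplication by [t] with [abs t < delta] carries the unit ball into the region where [f] is
     below 1; hence the bound [/ abs t]. *)
  have [delta [d0 fd]] := fC 0 1%Re Rlt_0_1.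
  have [t t0 [t1 td]] := exists_abs_lt Habs Hnontriv d0; have tp := abs_gt0 Habs t0.
  exists (/ abs t)%Re => a a1; apply: (Rmult_le_reg_l (abs t)) => //.
  rewrite Rinv_r; last lra.
  rewrite -(absM Habs) -fZ; have := fd (iota t * rt a); rewrite !subr0 f0 subr0 => H.
  apply/Rlt_le/H/(@abs_ext_lt _ (t ^+ p * a)) => //.
    by rewrite exprMn rtE rmorphM rmorphXn.
  rewrite (absM Habs) (absX Habs); apply: (Rle_lt_trans _ (pow (abs t) p)).
    rewrite -[X in (_ <= X)%Re]Rmult_1_r; apply: Rmult_le_compat_l => //.
    by apply: pow_le; lra.
  by rewrite -!Rpower_pow //; apply: Rlt_Rpower_l; [apply: lt_0_INR; apply/ltP|].
pose f y := g (epsilon (inhabits 0) (fun a => iota a = y ^+ p)).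
have fE y a : iota a = y ^+ p -> f y = g a.
  move=> Ea; congr g; apply: (fmorph_inj iota); rewrite Ea.
  by apply: (epsilon_spec _ (fun a => iota a = y ^+ p)); exists a.
have fD y z : f (y + z) = f y + f z.
  have [a Ea] := powL y; have [b Eb] := powL z.
  by rewrite (fE _ _ Ea) (fE _ _ Eb) -gD; apply: fE; rewrite rmorphD FrD Ea Eb.
have fB y z : f y - f z = f (y - z) by apply/eqP; rewrite subr_eq -fD subrK.
exists f; split=> //; split=> [c y|].
  have [a Ea] := powL y; rewrite (fE _ _ Ea) -gZ; apply: fE.
  by rewrite rmorphM rmorphXn exprMn Ea.
split=> [y0 eps eps0|]; last first.
  by have [y Ey] := rootL a0; exists y; rewrite (fE _ a0).
(* If [abs a] is below the p-th power of [/ abs c], then [c ^+ p * a] lies in the unit ball, so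
   [abs c * abs (g a) <= C < abs c * eps]. *)
have [c c0 cC] := exists_abs_gt Habs Hnontriv (C / eps)%Re; have cp := abs_gt0 Habs c0.
have ic := Rinv_0_lt_compat _ cp.
exists (/ abs c)%Re; split=> // y; have [a Ea] := powL (y - y0).
rewrite (abs_ext_lt Ea) // fB (fE _ _ Ea) => lt_a.
apply: (Rmult_lt_reg_l (abs c)) => //; rewrite -(absM Habs) -gZ.
apply: (Rle_lt_trans _ C).
  apply: gC; rewrite (absM Habs) (absX Habs) -(pow1 p) -(Rinv_r (abs c)); last lra.
  rewrite Rpow_mult_distr; apply: Rmult_le_compat_l; last lra.
  by apply: pow_le; lra.
have -> : C = (C / eps * eps)%Re by field; lra.
exact: Rmult_lt_compat_r.
Qed.

End RootExtension.

(** Rescaling by a small [t ^+ p] brings the ball of radius [M] into the unit ball, at the cost of a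
    factor [/ abs t]. *)
Lemma pinv_form_bounded_on_ball g : bounded_pinv_form g ->
  forall M, exists C, forall a, (abs a <= M)%Re -> (abs (g a) <= C)%Re.
Proof.
move=> [_ gZ [C gC]] M.
have [m m0 Mm] : exists2 m, (0 < m)%Re & (M <= m)%Re.
  by exists (Rmax M 0 + 1)%Re; have := Rmax_l M 0; have := Rmax_r M 0; lra.
have [|t t0 [t1 tm]] := exists_abs_lt Habs Hnontriv (eps := (/ m)%Re).
  exact: Rinv_0_lt_compat.
have tp := abs_gt0 Habs t0.
exists (/ abs t * C)%Re => a aM; apply: (Rmult_le_reg_l (abs t)) => //.
rewrite -Rmult_assoc Rinv_r ?Rmult_1_l; last lra.
rewrite -(absM Habs) -gZ; apply: gC; rewrite (absM Habs) (absX Habs).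
rewrite -(Rinv_l m); last lra.
apply: Rmult_le_compat; [by apply: pow_le; lra|exact: abs_ge0| |lra].
apply: (Rle_trans _ (abs t)); last lra.
rewrite -[p]prednK //= -[X in (_ <= X)%Re]Rmult_1_r; apply: Rmult_le_compat_l; first lra.
by rewrite -(pow1 p.-1); apply: pow_incr; lra.
Qed.

Lemma frobenius_split_of_pinv_form n g :
  bounded_pinv_form g -> (exists a, g a <> 0) -> frobenius_split n abs p.
Proof.
move=> Hg [a0 /eqP ga0]; have [gD gZ _] := Hg.
(* Precomposing with multiplication by [a0] moves the nonzero value to 1, and dividing by [g a0]
   makes [h 1 = 1]. *)
pose h a := (g a0)^-1 * g (a * a0).
have hball M : exists C, forall a, (abs a <= M)%Re -> (abs (h a) <= C)%Re.
  have [C gC] := pinv_form_bounded_on_ball Hg (M * abs a0)%Re.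
  exists (abs (g a0)^-1 * C)%Re => a aM; rewrite (absM Habs).
  apply: Rmult_le_compat_l; first exact: abs_ge0.
  by apply: gC; rewrite (absM Habs); apply: Rmult_le_compat_r => //; apply: abs_ge0.
have hD a b : h (a + b) = h a + h b by rewrite /h mulrDl gD mulrDr.
have hZ c a : h (c ^+ p * a) = c * h a by rewrite /h -mulrA gZ mulrCA.
have h1 : h 1 = 1 by rewrite /h mul1r mulVf.
have h0 : h 0 = 0 by have := hZ 0 0; rewrite mulr0 mul0r.
exists (fun x nu => h (x (fun i => p * nu i)%N)); split; first split=> [x|].
- move=> /(convergentP Habs Hnontriv)[t [t0 [t1 [M xM]]]].
  apply/(convergentP Habs Hnontriv); exists t; split=> //; split=> //.
  (* The same [t] works: with [e] the degree of [nu], the factor [t ^+ e] enters [h] as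
     [t ^+ (p * e)], and the bound on [x] at [p nu] keeps the argument of [h] within [M]. *)
  have [C hC] := hball M; exists C => nu.
  rewrite Rmult_comm -(absX Habs) -(absM Habs) -hZ; apply: hC.
  rewrite (absM Habs) Rmult_comm -exprM (absX Habs) mulnC big_distrr /=; exact: xM.
- split=> [x y _ _|r x _ _]; apply/functional_extensionality => nu; first exact: hD.
  (* One degree bound serves both products, so that their expansions match term by term. *)
  have lt_d : (\sum_(i < n) nu i < (\sum_(i < n) p * nu i).+1)%N.
    by rewrite ltnS; apply: leq_sum => i _; rewrite leq_pmull.
  rewrite (mul_psE _ _ lt_d) (mul_pow_psE _ _ Hp (ltnSn _)) (big_morph h hD h0).
  by apply: eq_bigr => m _; rewrite hZ.
apply/functional_extensionality => nu; rewrite /one_ps.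
have -> : [forall i, (p * nu i)%N == 0%N] = [forall i, nu i == 0%N].
  by apply: eq_forallb => i; rewrite muln_eq0 eqn0Ngt p_gt0.
by case: ifP.
Qed.

End PinvForms.

Lemma nat_least (P : nat -> Prop) :
  (exists m, P m) -> exists2 m, P m & forall l, (l < m)%N -> ~ P l.
Proof.
move=> exP; pose Q m : bool := if excluded_middle_informative (P m) then true else false.
have QP m : Q m <-> P m by rewrite /Q; case: excluded_middle_informative.
have exQ : exists m, Q m by case: exP => m /QP Qm; exists m.
have [m /QP Pm min_m] := ex_minnP exQ; exists m => // l lt_l /QP /min_m.
by rewrite leqNgt lt_l.
Qed.

(** * From a nonzero p^(-1)-linear map to a bounded form *)

Section PinvMapForm.
Import GRing.Theory.
Local Open Scope ring_scope.
Local Delimit Scope R_scope with Re.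
Variables (k : fieldType) (abs : k -> R) (p n : nat).
Hypothesis Habs : nonarch_abs abs.
Hypothesis Hnontriv : exists x : k, abs x <> 0%Re /\ abs x <> 1%Re.
Hypothesis p_gt0 : (0 < p)%N.
Implicit Types (x : series k n) (nu mu : 'I_n -> nat).

Lemma pow_le1 t m : (0 <= t <= 1)%Re -> (0 <= pow t m <= 1)%Re.
Proof.
by move=> t01; split; [apply: pow_le; lra|rewrite -(pow1 m); apply: pow_incr; lra].
Qed.

Lemma convergent_monomial_ps c mu : convergent abs (monomial_ps c mu).
Proof.
have [t t0 t1] := exists_abs_lt1 Habs Hnontriv; have tp := abs_gt0 Habs t0.
apply/(convergentP Habs Hnontriv); exists t; split=> //; split=> //.
exists (abs c) => nu; have [|P0 P1] := @pow_le1 (abs t) (\sum_(i < n) nu i); first lra.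
rewrite -[X in (_ <= X)%Re]Rmult_1_r; apply: Rmult_le_compat => //; first exact: abs_ge0.
rewrite /monomial_ps; case: ifP => _; first lra.
by rewrite (abs0 Habs); apply: abs_ge0.
Qed.

Lemma convergent_scale_ps c x : convergent abs x -> convergent abs (scale_ps c x).
Proof.
move=> /(convergentP Habs Hnontriv)[t [t0 [t1 [M xM]]]].
apply/(convergentP Habs Hnontriv); exists t; split=> //; split=> //.
exists (abs c * M)%Re => nu; rewrite (absM Habs) Rmult_assoc.
by apply: Rmult_le_compat_l => //; apply: abs_ge0.
Qed.

Variable i0 : 'I_n.

Definition shift_index mu e : 'I_n -> nat := fun l => (mu l - e * (l == i0))%N.

(* The product of [x] with the series [\sum_i u i 'X_i0 ^ (p i)]. *)
Definition lacunary_ps (u : nat -> k) x : series k n := fun mu =>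
  \sum_(0 <= i < (mu i0).+1 | (p * i <= mu i0)%N) u i * x (shift_index mu (p * i)).

(** Shifting an index does not raise its degree and [abs (u i) <= 1], so every term obeys the bound
    of [x], and the ultrametric inequality passes it to the sum. *)
Lemma convergent_lacunary_ps u x :
  (forall i, (abs (u i) <= 1)%Re) -> convergent abs x -> convergent abs (lacunary_ps u x).
Proof.
move=> u1 /(convergentP Habs Hnontriv)[t [t0 [t1 [M xM]]]].
have tp := abs_gt0 Habs t0.
have M0 : (0 <= M)%Re.
  apply: Rle_trans (xM (fun=> 0%N)); apply: Rmult_le_pos; first exact: abs_ge0.
  by apply: pow_le; lra.
apply/(convergentP Habs Hnontriv); exists t; split=> //; split=> //.
exists M => mu; rewrite -(absX Habs) -(absM Habs) mulr_suml.
apply: (abs_sum_le Habs) => // i _; rewrite !(absM Habs) (absX Habs) Rmult_assoc.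
apply: (Rle_trans _ (1 * M)); last lra.
have tn m : (0 <= pow (abs t) m)%Re by apply: pow_le; lra.
apply: Rmult_le_compat => //; first exact: abs_ge0.
  by apply: Rmult_le_pos => //; apply: abs_ge0.
apply: Rle_trans (xM (shift_index mu (p * i))).
apply: Rmult_le_compat_l; first exact: abs_ge0.
have le_deg : (\sum_(l < n) shift_index mu (p * i) l <= \sum_(l < n) mu l)%N.
  by apply: leq_sum => l _; apply: leq_subr.
rewrite -(subnKC le_deg) pow_add -[X in (_ <= X)%Re]Rmult_1_r.
apply: Rmult_le_compat_l => //; set e := subn _ _.
by have [|] := @pow_le1 (abs t) e; lra.
Qed.

Let X0 : series k n := monomial_ps 1 (fun l => nat_of_bool (l == i0)).

Lemma mul_X0_pow x e mu :
  mul_ps (pow_ps X0 e) x mu =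
  if (e <= mu i0)%N then x (shift_index mu e) else 0.
Proof.
rewrite pow_monomial_ps mul_monomial_ps expr1n mul1r.
have -> : [forall i, (e * (i == i0) <= mu i)%N] = (e <= mu i0)%N.
  apply/forallP/idP => [/(_ i0)|le i]; first by rewrite eqxx muln1.
  by have [->|_] := eqVneq; rewrite ?muln1 ?muln0.
by [].
Qed.

(** Splitting off the term [i = 0] leaves a multiple of the p-th power of [X0], the shape to which
    p^(-1)-linearity applies. *)
Lemma lacunary_ps_rec u x :
  lacunary_ps u x =
  add_ps (scale_ps (u 0%N) x)
         (mul_ps (pow_ps X0 p) (lacunary_ps (fun i => u i.+1) x)).
Proof.
apply/functional_extensionality => mu.
rewrite /add_ps /scale_ps mul_X0_pow /lacunary_ps.
rewrite big_ltn_cond // muln0 leq0n big_add1 /=; congr (_ + _).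
  congr (_ * x _); apply/functional_extensionality => l.
  by rewrite /shift_index mul0n subn0.
have -> : shift_index mu p i0 = (mu i0 - p)%N by rewrite /shift_index eqxx muln1.
case: leqP => [le_p|lt_p]; last first.
  rewrite big1 // => i; rewrite mulnS => le.
  by have := leq_trans (leq_addr _ _) le; rewrite leqNgt lt_p.
(* The shifted series has a shorter range; the indices added here are cut off by the guard. *)
rewrite [RHS](big_nat_widen _ _ (mu i0)); last by rewrite ltn_subrL p_gt0 (leq_trans p_gt0).
apply: eq_big => [i|i _]; last first.
  congr (_ * x _); apply/functional_extensionality => l.
  by rewrite /shift_index mulnS mulnDl subnDA.
rewrite mulnS -{1}(subnKC le_p) leq_add2l ltnS; apply/idP/andP => [le_i|[]//].
by split=> //; apply: leq_trans le_i; rewrite leq_pmull.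
Qed.

Lemma pinv_form_of_pinv_map : has_nonzero_pinv_map n abs p ->
  exists2 g, bounded_pinv_form abs p g & exists a, g a <> 0.
Proof.
move=> [phi [[phi_conv [phiD phiZ]] [x [xc phix]]]].
have [nu phix_nu] : exists nu, phi x nu <> 0.
  apply: NNPP => H; apply: phix; apply/functional_extensionality => nu.
  by apply: NNPP => H'; apply: H; exists nu.
pose at_ m : 'I_n -> nat := fun i => if i == i0 then m else nu i.
have at0 m : at_ m i0 = m by rewrite /at_ eqxx.
have sc c := convergent_scale_ps c xc.
pose f m a := phi (scale_ps a x) (at_ m).
have fD m a b : f m (a + b) = f m a + f m b.
  rewrite /f -[RHS]/(add_ps _ _ (at_ m)) -phiD //; congr phi.
  by apply/functional_extensionality => mu; rewrite /scale_ps /add_ps mulrDl.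
have fZ m c a : f m (c ^+ p * a) = c * f m a.
  (* Scalars act through constant series, which makes [c ^+ p] a p-th power among series. *)
  pose cst := monomial_ps c (fun _ : 'I_n => 0%N).
  have cstE z : mul_ps cst z = scale_ps c z.
    apply/functional_extensionality => mu; rewrite mul_monomial_ps.
    case: ifP => [_|/negbT/forallPn[i]//].
    by congr (_ * z _); apply/functional_extensionality => i; rewrite subn0.
  rewrite /f -[RHS]/(scale_ps c _ (at_ m)) -cstE -phiZ //; last first.
    exact: convergent_monomial_ps.
  congr phi; apply/functional_extensionality => mu.
  rewrite pow_monomial_ps mul_monomial_ps; case: ifP => [_|/negbT/forallPn[i]]; last first.
    by rewrite muln0.
  rewrite /scale_ps -mulrA; congr (_ * (_ * x _)).
  by apply/functional_extensionality => i; rewrite muln0 subn0.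
have [j fj fmin] : exists2 j, exists a, f j a <> 0 &
    forall l, (l < j)%N -> ~ exists a, f l a <> 0.
  apply: nat_least; exists (nu i0), 1; rewrite /f.
  have -> : at_ (nu i0) = nu.
    by apply/functional_extensionality => i; rewrite /at_; case: eqP => // ->.
  have -> : scale_ps 1 x = x; last by [].
  by apply/functional_extensionality => mu; rewrite /scale_ps mul1r.
have {}fmin l a : (l < j)%N -> f l a = 0.
  by move=> /fmin H; apply: NNPP => H'; apply: H; exists a.
exists (f j) => //; split=> //; apply: NNPP => unbounded.
have big_val B : exists a, (abs a <= 1)%Re /\ (B < abs (f j a))%Re.
  apply: NNPP => H; apply: unbounded; exists B => a a1.
  by apply: Rnot_lt_le => lt; apply: H; exists a.
pose pick B := proj1_sig (constructive_indefinite_description _ (big_val B)).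
have pickP B : (abs (pick B) <= 1)%Re /\ (B < abs (f j (pick B)))%Re.
  by rewrite /pick; case: constructive_indefinite_description.
pose deg m := (\sum_(i < n) at_ m i)%N.
(* The first threshold defeats every radius of convergence, as its base [INR s] itself grows; the
   second prevents cancellation. *)
pose next s (S : nat -> k) :=
  pick (Rmax (pow (INR s) (deg (s + j)%N)) (abs (S (s + j)%N))).
(* [S s m] is the contribution of [u 0, ..., u (s-1)] to the coefficient of index [m] of
   [phi y]; [u s] is chosen so large under [f j] that it dominates it. *)
pose S := fix S s : nat -> k :=
  if s is s'.+1 then fun m => S s' m + f (m - s')%N (next s' (S s')) else fun=> 0.
pose u s := next s (S s).
have u1 s : (abs (u s) <= 1)%Re by rewrite /u /next; set B := Rmax _ _; have [] := pickP B.
(* The tail of the series from index [s] on, with X_0^(p s) divided out. *)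
pose y s := lacunary_ps (fun i => u (s + i)%N) x.
have yc s : convergent abs (y s) by apply: convergent_lacunary_ps.
(* [phi] turns the factor X_0^p of the remaining tail into X_0, which lowers the index by one and
   contributes nothing at [m = 0]. *)
have phi_y s m : phi (y s) (at_ m) =
    f m (u s) + if m is m'.+1 then phi (y s.+1) (at_ m') else 0.
  have Xyc : convergent abs (mul_ps (pow_ps X0 p) (y s.+1)).
    (* The product is a lacunary series with leading coefficient 0, hence convergent. *)
    pose v i := if i is i'.+1 then u (s.+1 + i')%N else 0.
    have <- : lacunary_ps v x = mul_ps (pow_ps X0 p) (y s.+1).
      rewrite lacunary_ps_rec //; apply/functional_extensionality => mu.
      by rewrite /add_ps /scale_ps mul0r add0r.
    apply: convergent_lacunary_ps => // -[|i] //=; rewrite (abs0 Habs); lra.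
  rewrite /y lacunary_ps_rec // addn0.
  have -> : (fun i => u (s + i.+1)%N) = (fun i => u (s.+1 + i)%N).
    by apply/functional_extensionality => i; rewrite addnS.
  rewrite -/(y s.+1) (phiD _ _ (sc _) Xyc) phiZ //; last exact: convergent_monomial_ps.
  rewrite /add_ps; congr (_ + _).
  rewrite mul_monomial_ps mul1r; case: m => [|m].
    by case: ifP => // /forallP/(_ i0); rewrite at0 eqxx.
  rewrite ifT; last by apply/forallP => i; rewrite /at_; case: eqP.
  congr (phi _ _); apply/functional_extensionality => i; rewrite /at_.
  by case: eqP => _; rewrite ?subn1 ?subn0.
have phi_yj s : phi (y s) (at_ j) = f j (u s).
  (* By minimality of [j], no tail contributes below degree [j]; the induction treats all tails at
     once. *)
  suff phi_y_low l : (l < j)%N -> forall s, phi (y s) (at_ l) = 0.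
    have low l : (l <= j)%N -> (if l is l'.+1 then phi (y s.+1) (at_ l') else 0) = 0.
      by case: l => // l /phi_y_low.
    by rewrite phi_y low ?addr0.
  elim: l => [|l IHl] lt_l s'; rewrite phi_y fmin ?addr0 // IHl ?addr0 //.
  exact: ltnW.
have phi_y0 s m : (s <= m)%N -> phi (y 0%N) (at_ m) = S s m + phi (y s) (at_ (m - s)%N).
  elim: s => [|s IHs] lt_s; first by rewrite add0r subn0.
  rewrite IHs ?(ltnW lt_s) // phi_y addrA /= subnS -/(u s).
  by have := lt_s; rewrite -subn_gt0; case: (m - s)%N.
have grow s : (pow (INR s) (deg (s + j)%N) < abs (phi (y 0%N) (at_ (s + j)%N)))%Re.
  rewrite (phi_y0 s) ?leq_addr // addKn phi_yj.
  rewrite /u /next; set b := pow _ _; set c := abs (S s _).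
  have [_] := pickP (Rmax b c); have := Rmax_l b c; have := Rmax_r b c => *.
  by apply: (abs_add_gt Habs); rewrite -/c; lra.
have := phi_conv _ (yc 0%N).
move=> /(convergentP Habs Hnontriv)[t [t0 [t1 [M zM]]]]; have tp := abs_gt0 Habs t0.
(* As the degree is positive and [INR s * abs t] is at least 1, its power of that degree is at least
   [INR s * abs t], hence at least [M]; [grow] then contradicts the bound strictly. *)
have [s [s0 st1 stM]] : exists s,
    [/\ (0 < s)%N, (1 <= INR s * abs t)%Re & (M <= INR s * abs t)%Re].
  have [s Hs] := INR_archimed (abs t) (Rmax 1 M) tp.
  have := Rmax_l 1 M; have := Rmax_r 1 M => ??; exists s; split; try lra.
  by case: s Hs => //=; lra.
have := zM (at_ (s + j)%N); apply: Rlt_not_le; rewrite -/(deg _).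
apply: (Rle_lt_trans _ (pow (INR s * abs t) (deg (s + j)%N))); last first.
  rewrite Rpow_mult_distr; apply: Rmult_lt_compat_r => //; exact: pow_lt.
apply: Rle_trans stM _; rewrite -{1}[(INR s * abs t)%Re]pow_1; apply: Rle_pow => //.
by apply/leP; rewrite /deg (bigD1 i0) //= at0 addn_gt0 addn_gt0 s0.
Qed.

End PinvMapForm.

Theorem mainTheorem5 (k : fieldType) (abs : k -> R) (p : nat)
  (Hk : nonarch_field abs) (Hp : (p \in [pchar k])%R)
  (L : fieldType) (iota : {rmorphism k -> L}) (HL : is_pth_root_ext p iota) :
  [<-> (forall n : nat, (0 < n)%N -> frobenius_split n abs p);
       (forall n : nat, (0 < n)%N -> has_nonzero_pinv_map n abs p);
       (exists n : nat, (0 < n)%N /\ has_nonzero_pinv_map n abs p);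
       has_nonzero_pinv_map 1 abs p;
       frobenius_split 1 abs p;
       has_nonzero_cont_klinear abs p iota].
Proof.
have [Habs [_ Hnt]] := Hk.
have p_gt0 : (0 < p)%N by rewrite prime_gt0 ?(GRing.pcharf_prime Hp).
have form_split n : has_nonzero_cont_klinear abs p iota -> frobenius_split n abs p.
  move=> /(cont_klinear_pinv_formP Habs Hnt Hp HL)[g Hg g0].
  exact: (frobenius_split_of_pinv_form Habs Hnt Hp n Hg g0).
have map_form n : (0 < n)%N -> has_nonzero_pinv_map n abs p ->
    has_nonzero_cont_klinear abs p iota.
  move=> n_gt0 Hphi; apply/(cont_klinear_pinv_formP Habs Hnt Hp HL).
  exact: (pinv_form_of_pinv_map Habs Hnt p_gt0 (Ordinal n_gt0)).
have split_map n : frobenius_split n abs p -> has_nonzero_pinv_map n abs p.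
  move=> [phi [Hphi phi1]]; exists phi; split=> //; exists (@one_ps k n); split.
    (* [one_ps] is convertible to the monomial with coefficient 1 and exponent 0. *)
    exact: convergent_monomial_ps.
  rewrite phi1 => /(congr1 (fun a => a (fun=> 0%N))); rewrite /one_ps /zero_ps.
  by case: ifP => [_ /eqP|/negbT/forallPn[i]//]; rewrite GRing.oner_eq0.
tfae.
- by move=> Hn n n_gt0; apply/split_map/Hn.
- by move=> Hn; exists 1%N; split=> //; apply: Hn.
(* The passage from [n] variables to one goes through the form on k^(1/p), which does not depend on
   [n]. *)
- by move=> [n [n_gt0 /(map_form _ n_gt0) Hf]]; apply/split_map/form_split.
- by move=> /(map_form 1 isT) Hf; apply: form_split.
- by move=> /split_map/(map_form 1 isT).
- by move=> Hf n _; apply: form_split.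
Qed.
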